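(* If $N$ is an odd perfect number and $3\nmid N$, then $$\frac{51}{19}\,\omega(N) - \frac{46}{19} \leq \Omega(N).$$
   Context: A positive integer is perfect if the sum of its positive integer divisors equals twice itself. $\omega(N)$ denotes the number of distinct prime factors of $N$, and $\Omega(N)$ denotes the total number of prime factors of $N$ counted with multiplicity. *)

(* Defs.v *)
From mathcomp Require Import all_boot all_order all_algebra.

Set Implicit Arguments.
Unset Strict Implicit.
Unset Printing Implicit Defensive.

Definition perfect (N : nat) : Prop :=
  0 < N /\ \sum_(d <- divisors N) d = 2 * N.

Definition omega (N : nat) : nat := size (primes N).

Definition Omega (N : nat) : nat := \sum_(p <- primes N) logn p N.

(* Main.v *)
Require Import Defs.
From mathcomp Require Import all_boot all_order all_algebra.
From mathcomp Require Import zify ring lra.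

(** Write e_p for the exponent of the prime p in N and Phi3 p = p^2 + p + 1.
    Since sigma N = 2N and sigma is multiplicative, the product of the numbers
    sigma (p^e_p) is 2N.  Two consequences drive the proof.  Parity: at most
    one e_p is odd, so every other e_p is 2 or at least 4.  The primes that
    keep Omega N close to 2 * omega N are therefore those of the set S of p
    with e_p = 2, and S has to be shown small.  Divisibility: the product of
    Phi3 p over p in S divides N.  As 3 does not divide N, every p in S is
    2 mod 3 and every prime factor of Phi3 p lies in the set R of prime
    divisors of N that are 1 mod 3, which is disjoint from S; the factor r is
    available e_r times.

    Let A be the set of values Phi3 a with a in S; below, S, R and A are
    [sqr_primes N], [primes_1mod3 N] and [sqr_values N].  Each p in S collects
    at least 10 units from the primes in R, as follows: 3 for each prime factor
    of Phi3 p in A, 4 for each factor outside A ([charge]), and a [bonus] from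
    the largest prime factor when this factor exceeds p, equal to 7 if it is in
    A and to 3 otherwise.
    - If Phi3 p is prime, it is in A and p collects 7 + 3.
    - With two prime factors, the larger exceeds p, and p collects at least
      3 + 4 + 3 or 7 + 3 + 3.
    - With three prime factors, one of them is outside A (this is
      [Phi3_not_prod3]), and p collects at least 4 + 3 + 3.
    - With four or more factors, p collects at least 12.
    No prime r pays its bonus twice ([large_factor_inj]): if r divides Phi3 a
    and Phi3 b with a, b < r distinct, then r divides a + b + 1 < 2r, hence
    r = a + b + 1, which is 2 mod 3.  So r in R pays at most 3 e_r + 7 or
    4 e_r + 3, and 10 |S| is at most the sum of these payments.  Since e_r is
    not 2, a comparison of the payment with the contribution of r to
    19 * Omega N - 51 * omega N finishes the proof; the constant 46
    compensates for the possible prime of odd exponent.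

    That Phi3 p is not a product of three primes Phi3 a, Phi3 b, Phi3 c with
    a, b, c primes that are 2 mod 3 comes from the Eisenstein integers: if w
    is a primitive cube root of unity, then Phi3 p is the norm of p - w, so
    p - w would be, up to a unit, the product of the prime elements a - w,
    b - w, c - w or of their conjugates.  Comparing coordinates leaves only
    c (a + b + 1) = a b or a b - 2 (up to permutation), and neither has
    solutions. *)

Set Implicit Arguments.
Unset Strict Implicit.
Unset Printing Implicit Defensive.

(** * The sum of divisors *)

Definition sigma n := \sum_(d <- divisors n) d.

Lemma gcdn_mul_coprime k m n :
  coprime m n -> k %| m * n -> gcdn k m * gcdn k n = k.
Proof.
move=> co_mn k_mn; apply/eqP; rewrite eqn_dvd; apply/andP; split.
  rewrite Gauss_dvd ?dvdn_gcdl //.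
  by apply: coprime_dvdl (dvdn_gcdr _ _) (coprime_dvdr (dvdn_gcdr _ _) co_mn).
rewrite muln_gcdl !muln_gcdr !dvdn_gcd k_mn andbT.
by rewrite dvdn_mulr //= dvdn_mulr //= dvdn_mull.
Qed.

(** Multiplication maps pairs of divisors of m and n onto the divisors of
    m * n; for coprime m and n, gcds recover the pair from the product. *)
Lemma sigma_coprime m n :
  0 < m -> 0 < n -> coprime m n -> sigma (m * n) = sigma m * sigma n.
Proof.
move=> m_gt0 n_gt0 co_mn; rewrite /sigma.
have mn_gt0 : 0 < m * n by rewrite muln_gt0 m_gt0.
rewrite (perm_big [seq d * e | d <- divisors m, e <- divisors n]) /=; last first.
  apply: uniq_perm; first exact: divisors_uniq.
    apply: allpairs_uniq; try exact: divisors_uniq.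
    have rebuild d e : d %| m -> e %| n ->
        (gcdn (d * e) m, gcdn (d * e) n) = (d, e).
      move=> dm en; congr pair.
        rewrite gcdnC Gauss_gcdl; first exact/gcdn_idPr.
        exact: coprime_dvdr en co_mn.
      rewrite gcdnC Gauss_gcdr; first exact/gcdn_idPr.
      by rewrite coprime_sym; apply: coprime_dvdl dm co_mn.
    move=> u v /allpairsP[[d e] [/= + + ->]] /allpairsP[[d' e'] [/= + + ->]].
    rewrite -!dvdn_divisors // => dm en d'm e'n /= eq_de.
    by rewrite -(rebuild _ _ dm en) -(rebuild _ _ d'm e'n) eq_de.
  move=> k; rewrite -dvdn_divisors //; apply/idP/allpairsP.
    move=> k_mn; exists (gcdn k m, gcdn k n); split=> /=.
    - by rewrite -dvdn_divisors ?dvdn_gcdr.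
    - by rewrite -dvdn_divisors ?dvdn_gcdr.
    by rewrite gcdn_mul_coprime.
  move=> [[d e] [/= + + ->]]; rewrite -!dvdn_divisors //.
  exact: dvdn_mul.
by rewrite big_allpairs_dep big_distrlr.
Qed.

Lemma sigma_prime_pow p e : prime p -> sigma (p ^ e) = \sum_(i < e.+1) p ^ i.
Proof.
move=> p_pr; rewrite /sigma -(big_mkord xpredT (fun i => p ^ i)).
rewrite -(big_map (fun i => p ^ i) xpredT id); apply: perm_big.
apply: uniq_perm; first exact: divisors_uniq.
  rewrite map_inj_uniq ?iota_uniq //.
  by move=> i j /eqP; rewrite eqn_exp2l ?prime_gt1 // => /eqP.
move=> d; rewrite -dvdn_divisors ?expn_gt0 ?prime_gt0 //.
apply/dvdn_pfactor/mapP => //.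
  by move=> [i le_ie ->]; exists i; rewrite // mem_index_iota.
by move=> [i]; rewrite mem_index_iota => /= le_ie ->; exists i.
Qed.

Lemma odd_sigma_prime_pow p e :
  prime p -> odd p -> odd (sigma (p ^ e)) = ~~ odd e.
Proof.
move=> p_pr p_odd; rewrite sigma_prime_pow //.
elim: e => [|e IHe]; first by rewrite big_ord_recr big_ord0.
by rewrite big_ord_recr /= oddD IHe oddX p_odd orbT addbT.
Qed.

Lemma prod_seq_gt0 (T : eqType) (s : seq T) (F : T -> nat) :
  {in s, forall x, 0 < F x} -> 0 < \prod_(x <- s) F x.
Proof.
move=> F_gt0; rewrite big_seq; apply: (big_ind (fun n => 0 < n)) => // m n.
by rewrite muln_gt0 => -> ->.
Qed.

Lemma sigma_prod_primes (s : seq nat) (e : nat -> nat) :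
  uniq s -> all prime s ->
  sigma (\prod_(p <- s) p ^ e p) = \prod_(p <- s) sigma (p ^ e p).
Proof.
elim: s => [|p s IHs] /=; first by rewrite !big_nil /sigma big_cons big_nil.
move=> /andP[p_s s_uniq] /andP[p_pr s_pr]; rewrite !big_cons.
rewrite sigma_coprime ?IHs //; first by rewrite expn_gt0 prime_gt0.
  apply: prod_seq_gt0 => q /(allP s_pr) q_pr.
  by rewrite expn_gt0 prime_gt0.
rewrite big_seq; apply big_rec => [|q x q_s IHx]; first exact: coprimen1.
rewrite coprimeMr IHx andbT coprimeXl // coprimeXr //.
rewrite prime_coprime // dvdn_prime2 ?(allP s_pr q q_s) //.
by apply: contraNneq p_s => ->.
Qed.

Lemma prod_primes_logn n : 0 < n -> \prod_(p <- primes n) p ^ logn p n = n.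
Proof.
move=> n_gt0; rewrite [RHS]prod_prime_decomp // prime_decompE big_map.
by apply: eq_bigr.
Qed.

Lemma sigmaE n : 0 < n -> sigma n = \prod_(p <- primes n) sigma (p ^ logn p n).
Proof.
move=> n_gt0; rewrite -{1}(prod_primes_logn n_gt0) sigma_prod_primes //.
  exact: primes_uniq.
exact: all_prime_primes.
Qed.

(** * Factorizations into lists of primes *)

Lemma prime_factorization m : 0 < m ->
  exists2 l, all prime l & m = \prod_(r <- l) r.
Proof.
move=> m_gt0.
elim/ltn_ind: m m_gt0 => -[|[|m]] // IHm _.
  by exists [::]; rewrite ?big_nil.
have p_m := pdiv_dvd m.+2; have p_pr : prime (pdiv m.+2) by apply: pdiv_prime.
have [||l l_pr def_m] := IHm (m.+2 %/ pdiv m.+2).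
- by rewrite ltn_Pdiv ?prime_gt1.
- by rewrite divn_gt0 ?prime_gt0 // dvdn_leq.
exists (pdiv m.+2 :: l); first by rewrite /= p_pr.
by rewrite big_cons -def_m mulnC divnK.
Qed.

(** This converts a weighted sum of valuations, which adds up well over several
    integers, into a sum over the individual prime factors of one of them. *)
Lemma sum_logn_prod (l R : seq nat) (k : nat -> nat) :
  uniq R -> all prime l -> {subset l <= R} ->
  \sum_(r <- R) logn r (\prod_(x <- l) x) * k r = \sum_(x <- l) k x.
Proof.
move=> R_uniq; elim: l => [|x l IHl] /=.
  by move=> _ _; rewrite !big_nil big1 // => r _; rewrite logn1.
move=> /andP[x_pr l_pr] sub_lR; rewrite !big_cons -IHl //; last first.
  by move=> y y_l; rewrite sub_lR // inE y_l orbT.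
have xR : x \in R by rewrite sub_lR // mem_head.
have prod_gt0 : 0 < \prod_(y <- l) y.
  by apply: prod_seq_gt0 => y /(allP l_pr); apply: prime_gt0.
under eq_bigr => r _ do rewrite (lognM r (prime_gt0 x_pr) prod_gt0) mulnDl.
rewrite big_split /=; congr addn.
rewrite (bigD1_seq x) //= big1 ?addn0 => [|r /negPf r_x].
  by rewrite logn_prime // eqxx mul1n.
by rewrite logn_prime // r_x.
Qed.

Lemma logn_prod (T : eqType) (s : seq T) (F : T -> nat) r :
  {in s, forall x, 0 < F x} ->
  logn r (\prod_(x <- s) F x) = \sum_(x <- s) logn r (F x).
Proof.
elim: s => [|x s IHs] F_gt0; first by rewrite !big_nil logn1.
have F_gt0' : {in s, forall y, 0 < F y}.
  by move=> y y_s; apply: F_gt0; rewrite inE y_s orbT.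
by rewrite !big_cons lognM ?IHs ?prod_seq_gt0 // F_gt0 ?mem_head.
Qed.

Lemma leq_sum_uniq_sub (T : eqType) (s t : seq T) (F : T -> nat) :
  uniq s -> uniq t -> {subset s <= t} ->
  \sum_(x <- s) F x <= \sum_(x <- t) F x.
Proof.
move=> s_uniq t_uniq sub_st.
rewrite (perm_big [seq x <- t | x \in s]); last first.
  apply: uniq_perm; rewrite ?filter_uniq // => x; rewrite mem_filter.
  by case x_s: (x \in s); rewrite //= sub_st.
by rewrite big_filter [leqRHS](bigID (fun x => x \in s)) leq_addr.
Qed.

(** * Prime factors of a^2 + a + 1 *)

Definition Phi3 a := a ^ 2 + a + 1.

Lemma sigma_prime_sqr p : prime p -> sigma (p ^ 2) = Phi3 p.
Proof.
by move=> p_pr; rewrite sigma_prime_pow // !big_ord_recr big_ord0 /= /Phi3; lia.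
Qed.

Lemma Phi3_odd a : odd (Phi3 a).
Proof. by rewrite /Phi3 !oddD oddX /=; case: odd. Qed.

Lemma Phi3_gt0 a : 0 < Phi3 a.
Proof. by rewrite /Phi3 addn1. Qed.

(** Modulo r, the order of a divides 3.  Fermat's little theorem makes it also
    divide r - 1, so that a is 1 when r is 2 mod 3, and then r divides 3. *)
Lemma prime_dvd_Phi3 r a : prime r -> r %| Phi3 a ->
  r = 3 \/ r = 1 %[mod 3].
Proof.
rewrite /Phi3 => r_pr r_a.
have a3 : a ^ 3 = 1 %[mod r].
  apply/eqP; case: a r_a => [|a] r_a.
    by move: r_a; rewrite dvdn1 => /eqP ->; rewrite !modn1.
  rewrite eqn_mod_dvd ?expn_gt0 //.
  by rewrite (_ : _ - 1 = a * (a.+1 ^ 2 + a.+1 + 1)) ?dvdn_mull //; nia.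
have r_gt1 := prime_gt1 r_pr.
have [r3|[r3|r3]] : r %% 3 = 0 \/ r %% 3 = 1 \/ r %% 3 = 2 by lia.
- by left; apply/esym/eqP; rewrite -dvdn_prime2 //; apply/eqP.
- by right.
left.
have ar : a ^ r = a ^ 2 %[mod r].
  have {1}-> : r = 3 * (r %/ 3) + 2 by lia.
  by rewrite expnD expnM -modnMml -modnXm a3 modnXm exp1n modnMml mul1n.
have aa : a ^ 2 = a %[mod r] by rewrite -ar fermat_little.
have a1 : a = 1 %[mod r].
  by rewrite -{1}aa -a3 [in RHS](expnSr a 2) -[RHS]modnMml aa modnMml mulnn.
have : r %| 3.
  rewrite /dvdn -[3]/(1 ^ 2 + 1 + 1) in r_a *.
  move: r_a; rewrite -(modnDml (_ + _)) -(modnDm (a ^ 2)) -modnXm a1 modnXm.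
  by rewrite modnDm modnDml.
by rewrite dvdn_prime2 // => /eqP.
Qed.

(** If a < b, then r divides Phi3 b - Phi3 a = (b - a) (a + b + 1).  The first
    factor is less than r and the second one less than 2 r, so r is a + b + 1,
    which is 2 mod 3. *)
Lemma large_factor_inj r a b : prime r -> r = 1 %[mod 3] ->
  a = 2 %[mod 3] -> b = 2 %[mod 3] -> a < r -> b < r ->
  r %| Phi3 a -> r %| Phi3 b -> a = b.
Proof.
move=> r_pr r3; wlog le_ab : a b / a <= b.
  by move=> IH *; case: (leqP a b) => [|/ltnW] le; [|apply/esym]; apply: IH.
move=> a3 b3 lt_ar lt_br r_a r_b.
have : r %| (b - a) * (a + b + 1).
  suff <- : Phi3 b - Phi3 a = (b - a) * (a + b + 1) by apply: dvdn_sub.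
  by rewrite -{1 3}(subnK le_ab) /Phi3; set d := b - a; lia.
rewrite Euclid_dvdM // => /orP[r_ba|/dvdnP[k def_k]].
  case: (posnP (b - a)) => [|ba_gt0]; first by lia.
  by have := dvdn_leq ba_gt0 r_ba; lia.
have k1 : k = 1 by case: k def_k => [|[|k]] //; lia.
by move: def_k; rewrite k1; lia.
Qed.

(** * Products of three values of Phi3 and the Eisenstein integers *)

Section Eisenstein.
Import GRing.Theory.
Local Open Scope ring_scope.

(** Here x^2 + x y + y^2 is the norm of x - y w and r is the norm of a - w: a
    rational prime r that divides the norm of x - y w has a factor a - w, or
    its conjugate -(- a - 1 - w) up to sign, that divides x - y w.  The
    quotient is u - v w. *)
Lemma eisenstein_div (r : nat) (a x y : int) :
  prime r -> r%:Z = a ^+ 2 + a + 1 -> (r %| x ^+ 2 + x * y + y ^+ 2)%Z ->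
  exists2 a' : int, a' = a \/ a' = - a - 1 & exists u v : int,
    [/\ x = a' * u - v, y = u + (a' + 1) * v &
        x ^+ 2 + x * y + y ^+ 2 = r%:Z * (u ^+ 2 + u * v + v ^+ 2)].
Proof.
move=> r_pr def_r r_xy.
have step a' : r%:Z = a' ^+ 2 + a' + 1 -> (r %| x - a' * y)%Z ->
    exists u v : int, [/\ x = a' * u - v, y = u + (a' + 1) * v &
      x ^+ 2 + x * y + y ^+ 2 = r%:Z * (u ^+ 2 + u * v + v ^+ 2)].
  move=> def_r' /dvdzP[m def_m]; exists (y + (a' + 1) * m), (- m).
  have {def_m} -> : x = a' * y + m * r%:Z by rewrite -def_m; ring.
  by rewrite def_r'; split; ring.
have : (r %| (x - a * y) * (x - (- a - 1) * y))%Z.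
  have -> : (x - a * y) * (x - (- a - 1) * y)
      = x ^+ 2 + x * y + y ^+ 2 - r%:Z * y ^+ 2 by rewrite def_r; ring.
  by rewrite rpredB // dvdz_mulr.
rewrite dvdzE abszM Euclid_dvdM // => /orP[] r_dvd.
  by exists a; [left | apply: step].
exists (- a - 1); first by right.
by apply: step => //; rewrite def_r; ring.
Qed.

(** A unit u - v w is one of the six elements 1, w, w^2 and their opposites,
    so that multiplying X - Y w by it puts X, Y or X + Y, up to sign, in the
    coordinate of - w. *)
Lemma eisenstein_unit_mul (u v X Y : int) :
  u ^+ 2 + u * v + v ^+ 2 = 1 ->
  X <> 1 /\ X <> -1 -> Y <> 1 /\ Y <> -1 -> X + Y <> 1 /\ X + Y <> -1 ->
  u * Y + v * (X + Y) <> 1.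
Proof.
move=> uv1 HX HY HXY.
have u_small : -1 <= u <= 1 by nia.
have v_small : -1 <= v <= 1 by nia.
have [u1|[u0|u1]] : u = -1 \/ u = 0 \/ u = 1 by lia.
all: have [v1|[v0|v1]] : v = -1 \/ v = 0 \/ v = 1 by lia.
all: subst u v; lia.
Qed.

(** The product of a' - w, b' - w and c' - w is X - Y w.  The term a b c
    dominates X and X + Y, and Y is large when a', b' and c' have the same sign.
    Otherwise Y is, up to sign, c (a + b + 1) - a b + 1 or a permutation of it,
    which the last hypotheses keep away from 1 and - 1. *)
Lemma eisenstein_prod3_coords (a b c a' b' c' : int) :
  5 <= a -> 5 <= b -> 5 <= c ->
  a' = a \/ a' = - a - 1 -> b' = b \/ b' = - b - 1 -> c' = c \/ c' = - c - 1 ->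
  c * (a + b + 1) <> a * b /\ c * (a + b + 1) + 2 <> a * b ->
  b * (a + c + 1) <> a * c /\ b * (a + c + 1) + 2 <> a * c ->
  a * (b + c + 1) <> b * c /\ a * (b + c + 1) + 2 <> b * c ->
  let X := a' * b' * c' - a' - b' - c' - 1 in
  let Y := a' * b' + a' * c' + b' * c' + a' + b' + c' in
  [/\ X <> 1 /\ X <> -1, Y <> 1 /\ Y <> -1 & X + Y <> 1 /\ X + Y <> -1].
Proof.
move=> a_ge5 b_ge5 c_ge5.
have ab_ge : 5 * a <= a * b /\ 5 * b <= a * b by nia.
have ac_ge : 5 * a <= a * c /\ 5 * c <= a * c by nia.
have bc_ge : 5 * b <= b * c /\ 5 * c <= b * c by nia.
have abc_ge1 : 5 * (b * c) <= a * b * c by nia.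
have abc_ge2 : 5 * (a * c) <= a * b * c by nia.
have abc_ge3 : 5 * (a * b) <= a * b * c by nia.
do 3! case=> ->; move=> not_c not_b not_a X Y; rewrite /X /Y {X Y}.
all: by split; split; lia.
Qed.

(** If c (a + b + 1) = a b, the prime c is a or b, which is absurd.  If
    c (a + b + 1) = a b - 2, the left side is 2 * 5 and the right side 2 * 2 - 2
    modulo 3, that is, 1 and 2. *)
Lemma prod3_obstruction (a b c : nat) : prime a -> prime b -> prime c ->
  a = 2 %[mod 3] -> b = 2 %[mod 3] -> c = 2 %[mod 3] ->
  c%:Z * (a%:Z + b%:Z + 1) <> a%:Z * b%:Z /\
  c%:Z * (a%:Z + b%:Z + 1) + 2 <> a%:Z * b%:Z.
Proof.
move=> a_pr b_pr c_pr a3 b3 c3; split=> eqZ_ab.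
  have eq_ab : (c * (a + b + 1) = a * b)%N by lia.
  have : (c %| a * b)%N by rewrite -eq_ab dvdn_mulr.
  have a_gt0 := prime_gt0 a_pr; have b_gt0 := prime_gt0 b_pr.
  rewrite Euclid_dvdM // !dvdn_prime2 // => /orP[] /eqP def_c; subst c.
    by move/eqP: eq_ab; rewrite eqn_pmul2l //; lia.
  by move/eqP: eq_ab; rewrite (mulnC a) eqn_pmul2l //; lia.
have [i def_a] : exists i, a = (3 * i + 2)%N by exists (a %/ 3)%N; lia.
have [j def_b] : exists i, b = (3 * i + 2)%N by exists (b %/ 3)%N; lia.
have [k def_c] : exists i, c = (3 * i + 2)%N by exists (c %/ 3)%N; lia.
by subst; lia.
Qed.

Lemma Phi3Z (a : nat) : (Phi3 a)%:Z = a%:Z ^+ 2 + a%:Z + 1.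
Proof. by rewrite /Phi3; lia. Qed.

(** Splitting off three prime elements from p - w leaves a unit, whose
    coordinates [eisenstein_unit_mul] and [eisenstein_prod3_coords] make
    incompatible with the coordinate 1 of p - w. *)
Lemma Phi3_not_prod3 (p a b c : nat) : prime a -> prime b -> prime c ->
  odd a -> odd b -> odd c ->
  a = 2 %[mod 3] -> b = 2 %[mod 3] -> c = 2 %[mod 3] ->
  prime (Phi3 a) -> prime (Phi3 b) -> prime (Phi3 c) ->
  Phi3 p <> (Phi3 a * Phi3 b * Phi3 c)%N.
Proof.
have ge5 (q : nat) : odd q -> q = 2 %[mod 3] -> 5 <= q%:Z :> int by lia.
move=> a_pr b_pr c_pr a_odd b_odd c_odd a3 b3 c3 ra_pr rb_pr rc_pr eq_p.
have norm0 : p%:Z ^+ 2 + p%:Z * 1 + 1 ^+ 2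
    = (Phi3 a)%:Z * ((Phi3 b)%:Z * (Phi3 c)%:Z) :> int.
  by rewrite mulrA -!PoszM -eq_p Phi3Z; ring.
have nz (q : nat) : prime (Phi3 q) -> (Phi3 q)%:Z != 0.
  by move=> q_pr; rewrite eqz_nat -lt0n prime_gt0.
have [|a' a'E [x1 [y1 [_ def_1 norm1]]]] :=
  @eisenstein_div _ _ p%:Z 1 ra_pr (Phi3Z a).
  by rewrite norm0 dvdz_mulr.
move: norm1; rewrite norm0 => /(mulfI (nz _ ra_pr))/esym norm1.
have [|b' b'E [x2 [y2 [def_x1 def_y1 norm2]]]] :=
  @eisenstein_div _ _ x1 y1 rb_pr (Phi3Z b).
  by rewrite norm1 dvdz_mulr.
move: norm2; rewrite norm1 => /(mulfI (nz _ rb_pr))/esym norm2.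
have [|c' c'E [u [v [def_x2 def_y2 norm3]]]] :=
  @eisenstein_div _ _ x2 y2 rc_pr (Phi3Z c).
  by rewrite norm2.
have {}norm3 : u ^+ 2 + u * v + v ^+ 2 = 1.
  by apply: (mulfI (nz _ rc_pr)); rewrite -norm3 norm2 mulr1.
have [HX HY HXY] := eisenstein_prod3_coords (ge5 _ a_odd a3) (ge5 _ b_odd b3)
  (ge5 _ c_odd c3) a'E b'E c'E (prod3_obstruction a_pr b_pr c_pr a3 b3 c3)
  (prod3_obstruction a_pr c_pr b_pr a3 c3 b3)
  (prod3_obstruction b_pr c_pr a_pr b3 c3 a3).
apply: (eisenstein_unit_mul norm3 HX HY HXY).
by rewrite [RHS]def_1 def_x1 def_y1 def_x2 def_y2; ring.
Qed.

End Eisenstein.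

(** * Odd perfect numbers prime to 3 *)

Definition sqr_primes N := [seq p <- primes N | logn p N == 2].

Definition primes_1mod3 N := [seq r <- primes N | r %% 3 == 1].

Definition sqr_values N := [seq Phi3 a | a <- sqr_primes N].

Definition charge N r := if r \in sqr_values N then 3 else 4.

Definition bonus N r := if r \in sqr_values N then 7 else 3.

Lemma perfect_prod N : perfect N ->
  \prod_(p <- primes N) sigma (p ^ logn p N) = 2 * N.
Proof. by case=> N_gt0 sigmaN; rewrite -sigmaE. Qed.

(** The product of the Phi3 p divides sigma N = 2 * N and is odd. *)
Lemma prod_Phi3_dvd N : perfect N -> \prod_(p <- sqr_primes N) Phi3 p %| N.
Proof.
move=> N_perf; set P := \prod_(p <- _) _.
have P_odd : odd P.
  rewrite /P; apply: (big_ind odd) => // [m n|p _]; last exact: Phi3_odd.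
  by rewrite oddM => -> ->.
have : P %| 2 * N.
  rewrite -(perfect_prod N_perf) (bigID (fun p => logn p N == 2)) /=.
  rewrite -big_filter (_ : P = \prod_(p <- sqr_primes N) sigma (p ^ logn p N)).
    exact: dvdn_mulr.
  apply: eq_big_seq => p; rewrite mem_filter => /andP[/eqP-> p_N].
  by rewrite sigma_prime_sqr //; apply: (allP (all_prime_primes N)).
by rewrite Gauss_dvdr // coprimen2.
Qed.

(** Each odd exponent makes one more factor of sigma N = 2 * N even, and 4 does
    not divide 2 * N. *)
Lemma one_odd_exponent N : perfect N -> odd N ->
  \sum_(p <- primes N) odd (logn p N) <= 1.
Proof.
move=> N_perf N_odd; have [N_gt0 _] := N_perf.
have : 2 ^ (\sum_(p <- primes N) odd (logn p N)) %| 2 * N.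
  rewrite -(perfect_prod N_perf) expn_sum big_seq [X in _ %| X]big_seq.
  apply: (big_ind2 (fun m n => m %| n)) => // [*|p]; first exact: dvdn_mul.
  rewrite mem_primes => /and3P[p_pr _ p_N].
  case e_odd: (odd _); last exact: dvd1n.
  by rewrite expn1 dvdn2 odd_sigma_prime_pow ?e_odd //; apply: dvdn_odd p_N N_odd.
rewrite pfactor_dvdn // ?muln_gt0 ?N_gt0 // lognM //.
by rewrite (@logn_coprime 2 N) ?coprime2n // logn_prime.
Qed.

Section Counting.

Variables (N : nat) (N_perfect : perfect N) (N_odd : odd N).
Hypothesis N_not3 : ~~ (3 %| N).

Let S := sqr_primes N.
Let R := primes_1mod3 N.

Lemma perfect_gt0 : 0 < N. Proof. by case: N_perfect. Qed.

Lemma Phi3_dvd p : p \in S -> Phi3 p %| N.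
Proof.
move=> p_S; apply: dvdn_trans (prod_Phi3_dvd N_perfect).
by rewrite (big_rem p) //= dvdn_mulr.
Qed.

(** If p were 1 mod 3, then 3 would divide Phi3 p, hence N. *)
Lemma sqr_prime_spec p : p \in S -> [/\ prime p, odd p & p = 2 %[mod 3]].
Proof.
move=> p_S; move: (p_S); rewrite mem_filter mem_primes => /and4P[_ p_pr _ p_N].
split=> //; first exact: dvdn_odd p_N N_odd.
have not3 n : n %| N -> ~~ (3 %| n).
  by move=> n_N; apply: contra N_not3 => /dvdn_trans->.
have := not3 _ p_N; have := not3 _ (Phi3_dvd p_S); rewrite /Phi3 => np nP.
have [|[p3|]] : p %% 3 = 0 \/ p %% 3 = 1 \/ p %% 3 = 2 by lia.
- by move=> p3; case/negP: nP; apply/eqP.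
- case/negP: np; have -> : p = 3 * (p %/ 3) + 1 by lia.
  by apply/dvdnP; exists (3 * (p %/ 3) ^ 2 + 3 * (p %/ 3) + 1); lia.
- by [].
Qed.

Lemma Phi3_factor_in p r : p \in S -> prime r -> r %| Phi3 p -> r \in R.
Proof.
move=> p_S r_pr r_p; have r_N := dvdn_trans r_p (Phi3_dvd p_S).
rewrite mem_filter mem_primes r_pr perfect_gt0 r_N !andbT.
case: (prime_dvd_Phi3 r_pr r_p) => [r3|->] //.
by case/negP: N_not3; rewrite -r3.
Qed.

Lemma charge_ge3 r : 3 <= charge N r.
Proof. by rewrite /charge; case: ifP. Qed.

Lemma sqr_valueP r : prime r -> r \in sqr_values N ->
  exists a, [/\ prime a, odd a, a = 2 %[mod 3], prime (Phi3 a) & r = Phi3 a].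
Proof.
move=> r_pr /mapP[a a_S def_r]; have [a_pr a_odd a3] := sqr_prime_spec a_S.
by exists a; split=> //; rewrite -def_r.
Qed.

(** The cases are the possible numbers of prime factors of Phi3 p; with four
    or more, the charges alone suffice. *)
Lemma collected_ge10 p : p \in S ->
  10 <= (if p < max_pdiv (Phi3 p) then bonus N (max_pdiv (Phi3 p)) else 0)
        + \sum_(r <- R) logn r (Phi3 p) * charge N r.
Proof.
move=> p_S; have [p_pr _ _] := sqr_prime_spec p_S.
have p_gt1 := prime_gt1 p_pr.
have Phi3_gt : p * p < Phi3 p by rewrite /Phi3; lia.
have Phi3_gt1 : 1 < Phi3 p by rewrite /Phi3; lia.
have [l l_pr def_l] := prime_factorization (Phi3_gt0 p).
have l_dvd x : x \in l -> x %| Phi3 p.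
  by move=> x_l; rewrite def_l (big_rem x) //= dvdn_mulr.
have l_le x : x \in l -> x <= max_pdiv (Phi3 p).
  move=> x_l; apply: max_pdiv_max.
  by rewrite mem_primes (allP l_pr) // Phi3_gt0 l_dvd.
have top_pr := max_pdiv_prime Phi3_gt1.
have top_l : max_pdiv (Phi3 p) \in l.
  have : max_pdiv (Phi3 p) %| \prod_(x <- l) x.
    by rewrite -def_l; apply: max_pdiv_dvd.
  elim: (l) l_pr => [|x s IHs] /=; rewrite ?big_nil ?big_cons.
    by move=> _ /(dvdn_leq (ltn0Sn 0)); have := prime_gt1 top_pr; lia.
  move=> /andP[x_pr s_pr]; rewrite Euclid_dvdM // dvdn_prime2 // inE.
  by case/orP=> [->|/(IHs s_pr)->]; rewrite ?orbT.
(* the first two occurrences of Phi3 p, inside the bonus, are kept *)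
rewrite {3}def_l sum_logn_prod ?filter_uniq ?primes_uniq //; last first.
  by move=> x x_l; apply: (Phi3_factor_in p_S (allP l_pr _ x_l)); apply: l_dvd.
have k3 := charge_ge3.
case: l l_pr def_l {l_dvd} l_le top_l => [|x [|y [|z [|t l]]]] /=.
- by rewrite big_nil; lia.
- move=> _ def_x _; rewrite inE => /eqP top_x; rewrite big_seq1.
  rewrite big_seq1 in def_x; have top_A : max_pdiv (Phi3 p) \in sqr_values N.
    by rewrite top_x -def_x map_f.
  rewrite /bonus top_A top_x -def_x; have := k3 (Phi3 p).
  by rewrite ifT; [lia | nia].
- rewrite !big_cons !big_nil muln1 addn0 => _ def_xy l_le top_l.
  have x_le := l_le x (mem_head _ _).
  have y_le : y <= max_pdiv (Phi3 p) by apply: l_le; rewrite !inE eqxx orbT.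
  have kx := k3 x; have ky := k3 y.
  (* both factors cannot be at most p, since p * p < Phi3 p *)
  rewrite ifT; last by rewrite ltnNge; apply/negP => top_le; nia.
  rewrite /bonus; case: ifP => topA; first by lia.
  have ktop : charge N (max_pdiv (Phi3 p)) = 4 by rewrite /charge topA.
  move: top_l; rewrite !inE.
  by case/orP=> /eqP top_eq; rewrite -top_eq ktop in kx ky *; lia.
- rewrite !big_cons !big_nil muln1 addn0 mulnA.
  move=> /and4P[x_pr y_pr z_pr _] def_xyz _ _.
  apply: leq_trans (leq_addl _ _).
  suff : ~~ [&& x \in sqr_values N, y \in sqr_values N & z \in sqr_values N].
    by rewrite /charge; do 3! case: (_ \in _).
  apply/and3P=> -[/(sqr_valueP x_pr) [a [a_pr a_odd a3 xa_pr xa]]].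
  move=> /(sqr_valueP y_pr) [b [b_pr b_odd b3 yb_pr yb]].
  move=> /(sqr_valueP z_pr) [c [c_pr c_odd c3 zc_pr zc]].
  by apply: (@Phi3_not_prod3 p a b c); rewrite // def_xyz xa yb zc.
- move=> _ _ _ _; rewrite !big_cons.
  by have := k3 x; have := k3 y; have := k3 z; have := k3 t; lia.
Qed.

(** The largest prime factors that exceed their p are pairwise distinct
    elements of R. *)
Lemma sum_bonus_le :
  \sum_(p <- S | p < max_pdiv (Phi3 p)) bonus N (max_pdiv (Phi3 p))
    <= \sum_(r <- R) bonus N r.
Proof.
rewrite -big_filter -(big_map (fun p => max_pdiv (Phi3 p)) xpredT (bonus N)).
have top_pr p : p \in S -> prime (max_pdiv (Phi3 p)).
  move=> p_S; have [p_pr _ _] := sqr_prime_spec p_S.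
  by apply: max_pdiv_prime; have := prime_gt1 p_pr; rewrite /Phi3; lia.
have top_R p : p \in S -> max_pdiv (Phi3 p) \in R.
  move=> p_S; apply: (Phi3_factor_in p_S); first exact: top_pr.
  exact: max_pdiv_dvd.
apply: leq_sum_uniq_sub; last first.
- by move=> _ /mapP[p + ->]; rewrite mem_filter => /andP[_]; apply: top_R.
- by rewrite filter_uniq ?primes_uniq.
rewrite map_inj_in_uniq ?filter_uniq ?primes_uniq // => a b.
rewrite !mem_filter => /andP[lt_a a_S] /andP[lt_b b_S] eq_top.
have a_S' : a \in S by rewrite mem_filter.
have b_S' : b \in S by rewrite mem_filter.
have [_ _ a3] := sqr_prime_spec a_S'; have [_ _ b3] := sqr_prime_spec b_S'.
have := top_R a a_S'; rewrite mem_filter => /andP[/eqP top3 _].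
apply: (large_factor_inj (top_pr a a_S') top3 a3 b3 lt_a).
- by rewrite eq_top.
- exact: max_pdiv_dvd.
- by rewrite eq_top max_pdiv_dvd.
Qed.

(** Summing what each p in S collects and exchanging the sums, the charges of r
    occur as often as r divides the product of the Phi3 p, that is, at most e_r
    times. *)
Lemma sqr_primes_le :
  10 * size S <= \sum_(r <- R) (bonus N r + charge N r * logn r N).
Proof.
have {1}-> : 10 * size S = \sum_(p <- S) 10.
  by rewrite big_const_seq count_predT iter_addn_0.
apply: leq_trans (_ : \sum_(p <- S) _ <= _) _.
  by rewrite big_seq; apply: leq_sum => p; apply: collected_ge10.
rewrite -big_seq !big_split /= -big_mkcond /= leq_add ?sum_bonus_le //.
rewrite exchange_big /= leq_sum // => r _.
rewrite -big_distrl /= mulnC leq_mul2l; apply/orP; right.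
rewrite -logn_prod; last by move=> p _; apply: Phi3_gt0.
by rewrite dvdn_leq_log ?perfect_gt0 ?prod_Phi3_dvd.
Qed.

(** This is the wanted inequality localized at one prime: up to a factor 10,
    the coefficients 51, 19 and 46 appear next to 13 times the payment of r and
    the weight 13 * 10 of an element of S.  Exponent 2 gives
    equality, because r is then outside R; the next tightest cases are 4, with
    510 + 13 * 19 <= 190 * 4, and 1, with 510 + 13 * 10 <= 190 + 460. *)
Lemma payment_le r : r \in primes N ->
  510 + (if r %% 3 == 1 then 13 * (bonus N r + charge N r * logn r N) else 0)
  <= 190 * logn r N + 130 * (logn r N == 2) + 460 * odd (logn r N).
Proof.
move=> r_N; have e_gt0 : 0 < logn r N by rewrite logn_gt0.
have not2 : r %% 3 == 1 -> logn r N != 2.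
  move=> r3; apply/negP => e2; have r_S : r \in S by rewrite mem_filter e2.
  by have [_ _] := sqr_prime_spec r_S; rewrite (eqP r3).
rewrite /bonus /charge; case: ifP => [/not2|_]; last by lia.
by case: (r \in _) => /=; lia.
Qed.

Lemma omega_Omega_le : 51 * omega N <= 19 * Omega N + 46.
Proof.
have S_le := sqr_primes_le; have odd_le := one_odd_exponent N_perfect N_odd.
have sizeS : \sum_(r <- primes N) (logn r N == 2) = size S.
  rewrite size_filter -sum1_count [RHS]big_mkcond.
  by apply: eq_bigr => r _; case: eqP.
have : \sum_(r <- primes N)
    (510 + (if r %% 3 == 1
            then 13 * (bonus N r + charge N r * logn r N) else 0))
  <= \sum_(r <- primes N)
    (190 * logn r N + 130 * (logn r N == 2) + 460 * odd (logn r N)).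
  by rewrite big_seq [leqRHS]big_seq; apply: leq_sum => r; apply: payment_le.
have sum_lhs c d (W : nat -> nat) :
    \sum_(r <- primes N) (c + (if r %% 3 == 1 then d * W r else 0))
      = c * omega N + d * \sum_(r <- R) W r.
  rewrite big_split /= big_const_seq count_predT iter_addn_0 -big_mkcond.
  by rewrite big_filter big_distrr.
have sum_rhs c d e :
    \sum_(r <- primes N)
      (c * logn r N + d * (logn r N == 2) + e * odd (logn r N))
      = c * Omega N + d * size S + e * \sum_(r <- primes N) odd (logn r N).
  by rewrite !big_split -!big_distrr /= sizeS.
by rewrite sum_lhs sum_rhs; lia.
Qed.

End Counting.

Local Open Scope ring_scope.

Theorem theorem1p4 (N : nat) (N_perfect : perfect N) (N_odd : odd N)
    (N_not3 : ~~ (3 %| N)%N) :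
  51 / 19 * (omega N)%:R - 46 / 19 <= (Omega N)%:R :> rat.
Proof.
have := omega_Omega_le N_perfect N_odd N_not3.
rewrite -(Num.Theory.ler_nat rat) GRing.natrD !GRing.natrM => le_omega.
by lra.
Qed.
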